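(* Consider the triggered urn model described in the context with update function $F(x)=\rho x$ for some $\rho>0$, and trigger probabilities satisfying $p_n=p+O(n^{-\beta})$ as $n\to\infty$, where $0\le p<1$ and $\beta>p$. Let $C_\infty=\sup_n C_n$. Then for every observed color $c$, i.e. every color $c$ with $1\le c\le C_\infty$, there is a random variable $K(c)\in(0,\infty)$ such that $$\frac{K_{n,c}}{n^{1-p}}\longrightarrow K(c)\quad\text{almost surely as } n\to\infty.$$
   Context: Triggered (FAQ) urn model. The urn is empty at time $0$. Let $B_0=1$ and let $(B_n)_{n\ge1}$ be independent Bernoulli random variables with $\Pr(B_n=1)=p_n\in(0,1)$, independent of everything else in the construction. Let $F:[1,\infty)\to[0,\infty)$ be strictly increasing with $F(1)>0$. Colors are labelled $1,2,\dots$ in order of first appearance, and a history sequence $\mathcal S=(S_n)_{n\ge1}$ records one color per time step. For a color $c$, $K_{n,c}$ denotes the number of times $c$ has been registered in $\mathcal S$ up to and including time $n$; at time $n$ the urn contains, for each color $c$ already present, a weight $F(K_{n,c})$. At each time $n\ge1$: if $B_{n-1}=1$, a new color is added with weight $F(1)$ and registered in $\mathcal S$; if $B_{n-1}=0$, a color $c$ among those present is drawn with probability $F(K_{n-1,c})/\sum_{c'}F(K_{n-1,c'})$ (sum over colors present at time $n-1$), registered in $\mathcal S$, and its weight becomes $F(K_{n,c})$. $C_n=\sum_{i=0}^{n-1}B_i$ is the number of distinct colors present at time $n$. *)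

(* Defs.v *)
From HB Require Import structures.
From mathcomp Require Import all_boot all_order all_algebra.
From mathcomp Require Import all_classical all_reals all_analysis.
Set Implicit Arguments. Unset Strict Implicit. Unset Printing Implicit Defensive.
Import Order.TTheory GRing.Theory Num.Theory.
Import numFieldNormedType.Exports.
Local Open Scope classical_set_scope.
Local Open Scope ring_scope.

(* A (finite prefix of a) history is encoded by
   b : nat -> bool   (b i = B_i, i = 0,1,...)
   s : nat -> nat    (s i = S_i, the color registered at time i >= 1). *)

(* C_n = sum_{i=0}^{n-1} B_i : number of distinct colors present at time n *)
Definition Cnt (b : nat -> bool) (n : nat) : nat := (\sum_(i < n) b i)%N.

Definition Kcnt (s : nat -> nat) (n c : nat) : nat :=
  (\sum_(1 <= i < n.+1) (s i == c))%N.

Section Model.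
Variable R : realType.
Variable F : R -> R.
Variable pn : nat -> R.

Definition bern_factor (b : nat -> bool) (i : nat) : R :=
  if i.-1 == 0%N then (if b 0%N then 1 else 0)
  else (if b i.-1 then pn i.-1 else 1 - pn i.-1).

(* conditional probability of registering color s_i at time i, given the past
   and B_{i-1} = b_{i-1} *)
Definition draw_factor (b : nat -> bool) (s : nat -> nat) (i : nat) : R :=
  if b i.-1 then (if s i == (Cnt b i.-1).+1 then 1 else 0)
  else if (1 <= s i <= Cnt b i.-1)%N then
         F (Kcnt s i.-1 (s i))%:R /
         \sum_(1 <= c < (Cnt b i.-1).+1) F (Kcnt s i.-1 c)%:R
       else 0.

Definition path_prob (n : nat) (b : nat -> bool) (s : nat -> nat) : R :=
  \prod_(1 <= i < n.+1) (bern_factor b i * draw_factor b s i).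
End Model.

Definition is_triggered_urn (R : realType) (d : measure_display)
  (T : measurableType d) (P : probability T R) (F : R -> R) (pn : nat -> R)
  (B : nat -> T -> bool) (S : nat -> T -> nat) : Prop :=
  (forall i (v : bool), measurable [set w : T | B i w = v]) /\
  (forall i (k : nat), measurable [set w : T | S i w = k]) /\
  (forall n (b : nat -> bool) (s : nat -> nat),
     P [set w : T | forall i, (i < n)%N -> B i w = b i /\ S i.+1 w = s i.+1]
     = (path_prob F pn n b s)%:E).

(* Main.v *)
Require Import Defs.
From HB Require Import structures.
From mathcomp Require Import all_boot all_order all_algebra.
From mathcomp Require Import all_classical all_reals all_analysis.
From mathcomp Require Import measurable_realfun ring lra zify.
Import Order.TTheory GRing.Theory Num.Theory.
Import numFieldNormedType.Exports.
Local Open Scope classical_set_scope.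
Local Open Scope ring_scope.

Set Implicit Arguments.
Unset Strict Implicit.
Unset Printing Implicit Defensive.

(** The total weight at time n is [rho * n], so a color c already present is
    registered at time n+1 with conditional probability (1 - p_n) K_n / n.
    Hence, whenever k (g (k+1) - g k) = lam g k, the process g(K_n) / D_lam(n)
    with D_lam(n) = prod_{j<n} (1 + lam (1 - p_j) / j) is a martingale once c is
    present. Three choices of g are used.
    - g k = k and g k = k (k+1) (lam = 1, 2): K_n / D_1(n) has increments of
      second moment O(1 / D_1(n)). As D_1(n) / n^(1-p) has a positive limit, these
      are summable along n = k^N for N large, which gives almost sure convergence
      along k^N, and then along all n because K_n is nondecreasing and
      (k+1)^N / k^N -> 1.
    - g k = prod_{j<k} (1 - 1/(2j)), which is of order k^(-1/2) (lam = -1/2): the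
      moments of (n^(1-p) / K_n)^(1/2) stay bounded, so by Fatou the limit cannot
      vanish. *)

(** * Growth products and their asymptotics *)

Section Growth.
Context {R : realType}.
Variable pn : nat -> R.
Hypothesis pn01 : forall n, (1 <= n)%N -> 0 < pn n < 1.

Definition growth (lam : R) n : R := \prod_(1 <= j < n) (1 + lam * (1 - pn j) / j%:R).

Lemma growthS lam n : (0 < n)%N ->
  growth lam n.+1 = growth lam n * (1 + lam * (1 - pn n) / n%:R).
Proof. by move=> n0; rewrite /growth big_nat_recr. Qed.

Lemma growth_factor_gt0 lam j : -1 <= lam -> (0 < j)%N ->
  0 < 1 + lam * (1 - pn j) / j%:R.
Proof.
move=> lam1 j0; have /andP[p0 p1] := pn01 j0.
have j1 : 1 <= j%:R :> R by rewrite ler1n.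
have jp : 0 < j%:R :> R by exact: lt_le_trans ltr01 j1.
have : 0 < (j%:R + lam * (1 - pn j)) / j%:R by rewrite divr_gt0//; nra.
by rewrite mulrDl divff// gt_eqF.
Qed.

Lemma growth_gt0 lam n : -1 <= lam -> 0 < growth lam n.
Proof.
move=> lam1; rewrite /growth big_nat_cond; apply: prodr_gt0 => j.
by rewrite andbT => /andP[j0 _]; exact: growth_factor_gt0.
Qed.

Let N1 : -1 <= 1 :> R. Proof. by lra. Qed.

(** Each step multiplies the ratio by [(1 + 2x) / (1 + x)^2 <= 1]. It is the deterministic
    coefficient in the second moment of [K_n / D_1(n)], so its monotonicity gives that term a
    favourable sign. *)
Lemma growth_ratio_noninc n k : (0 < n)%N ->
  growth 2 (n + k) / growth 1 (n + k) ^+ 2 <= growth 2 n / growth 1 n ^+ 2.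
Proof.
move=> n0; elim: k => [|k IH]; first by rewrite addn0.
rewrite addnS; set l := (n + k)%N in IH *; have l0 : (0 < l)%N by rewrite /l; lia.
apply: le_trans IH; rewrite !growthS//.
have g1 := growth_gt0 l N1; have f1 := growth_factor_gt0 N1 l0.
have g2 : 0 < growth 2 l by apply: growth_gt0; lra.
rewrite mul1r in f1 *; rewrite -(mulrA 2) exprMn; set x := (1 - pn l) / _ in f1 *.
rewrite -mulf_div; apply: ler_piMr; first by rewrite divr_ge0 ?exprn_ge0 ?ltW.
by rewrite ler_pdivrMr ?exprn_gt0// mul1r; nra.
Qed.

Lemma growth1_ge1 n : 1 <= growth 1 n.
Proof.
elim: n => [|[|n] IH]; try by rewrite /growth big_geq.
apply: (le_trans IH); rewrite (growthS _ (ltn0Sn n)) ler_peMr//; first exact: le_trans IH.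
by rewrite lerDl mul1r divr_ge0// subr_ge0; have /andP[_ /ltW] := @pn01 n.+1 isT.
Qed.

(** Factor by factor, [(1 - x/2)^2 (1 + x) = 1 - 3x^2/4 + x^3/4 <= 1] on [[0, 1]]. This lets
    [sqrt (growth 1 n)] replace the inverse of [growth (-1/2) n]. *)
Lemma growth_half_bound n : growth (- 2^-1) n ^+ 2 * growth 1 n <= 1.
Proof.
elim: n => [|[|n] IH]; try by rewrite /growth !big_geq// expr1n mulr1.
rewrite !(growthS _ (ltn0Sn n)) exprMn mulrACA; apply: mulr_ile1 => //.
- by rewrite mulr_ge0// ?sqr_ge0// ltW// growth_gt0.
- by rewrite mulr_ge0// ?sqr_ge0// ltW// growth_factor_gt0.
rewrite mul1r -mulrA; set x := _ / n.+1%:R.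
have x1 : 0 <= x <= 1.
  have /andP[p0 p1] := @pn01 n.+1 isT.
  rewrite divr_ge0 ?ler_pdivrMr ?ltr0n// ?subr_ge0 ?(ltW p1)// mul1r.
  by rewrite (@le_trans _ _ 1)// ?ler1n// gerBl ltW.
by nra.
Qed.

End Growth.

(** * The negative-power eigenfunction and its lower bound *)

Section NegativePower.
Context {R : realType}.

(* An eigenfunction of the pure birth dynamics, k (g (k+1) - g k) = - g k / 2,
   of order k^(-1/2). *)
Definition negative_power k : R := \prod_(1 <= j < k) (1 - (2 * j%:R)^-1).

Lemma negative_powerS k : (0 < k)%N ->
  negative_power k.+1 = negative_power k * (1 - (2 * k%:R)^-1).
Proof. by move=> k0; rewrite /negative_power big_nat_recr. Qed.

Lemma negative_power_ge0 k : 0 <= negative_power k.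
Proof.
rewrite /negative_power big_nat_cond; apply: prodr_ge0 => j.
rewrite andbT => /andP[j0 _]; rewrite subr_ge0 invf_le1 ?mulr_gt0 ?ltr0n//.
by rewrite -natrM ler1n; lia.
Qed.

Lemma negative_power_lower k : (0 < k)%N ->
  4^-1 <= negative_power k ^+ 2 * k%:R.
Proof.
case: k => // -[_|k _]; first by rewrite /negative_power big_geq// expr1n mulr1; lra.
(* The induction runs on the stronger bound with index minus one as the factor: [(1 - 1/(2x))^2 x =
   x - 1 + 1/(4x) >= x - 1] makes that quantity nondecreasing, and it equals 1/4 at index 2. *)
suff : 4^-1 <= negative_power k.+2 ^+ 2 * k.+1%:R.
  move=> /le_trans; apply; rewrite ler_wpM2l ?exprn_ge0 ?negative_power_ge0//.
  by rewrite ler_nat.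
elim: k => [|k IH].
  by rewrite negative_powerS// /negative_power big_geq// mulr1 mul1r; lra.
apply: le_trans IH _; rewrite (negative_powerS (ltn0Sn k.+1)) exprMn -[leRHS]mulrA.
rewrite ler_wpM2l ?exprn_ge0 ?negative_power_ge0//.
have x0 : 0 < k.+2%:R :> R by rewrite ltr0n.
rewrite (_ : (_ ^+ 2) * _ = k.+2%:R - 1 + (4 * k.+2%:R)^-1); last first.
  by field; rewrite gt_eqF.
by rewrite -[in leRHS](addn1 k.+1) natrD addrK lerDl invr_ge0 mulr_ge0// ltW.
Qed.

(** The shifted factor covers index 0 as well, where [negative_power] is an empty product. *)
Lemma negative_power_lowerS k : 4^-1 <= negative_power k ^+ 2 * k.+1%:R.
Proof.
case: k => [|k]; first by rewrite /negative_power big_geq// expr1n mulr1; lra.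
have := @negative_power_lower k.+1 isT => /le_trans; apply.
by rewrite ler_wpM2l ?sqr_ge0// ler_nat.
Qed.

End NegativePower.

(** * Real powers, logarithms and convergence along subsequences *)

Section PowerAsymptotics.
Context {R : realType}.
Implicit Types (a q x : R) (n : nat).

Lemma gt0_powRD x r s : 0 < x -> x `^ (r + s) = x `^ r * x `^ s.
Proof. by move=> x0; rewrite powRD ?(gt_eqF x0) ?implybT. Qed.

(** With [x = n+2] and [y = n+1], the quotient of the powers is [exp (a (ln x - ln y))]; then
    [exp t >= 1 + t] and [ln (y/x) <= -1/x]. *)
Lemma powR_shift_lower a n : 0 < a ->
  n.+2%:R `^ (- a) * (1 + a / n.+2%:R) <= n.+1%:R `^ (- a) :> R.
Proof.
move=> a0; have x0 : 0 < n.+2%:R :> R by rewrite ltr0n.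
have y0 : 0 < n.+1%:R :> R by rewrite ltr0n.
rewrite /powR !gt_eqF//.
have -> : - a * ln n.+1%:R = - a * ln n.+2%:R + a * (ln n.+2%:R - ln n.+1%:R).
  by ring.
rewrite expRD ler_wpM2l ?expR_ge0//; apply: le_trans (expR_ge1Dx _).
rewrite lerD2l ler_pM2l// -ln_div ?posrE//.
have : ln (n.+1%:R / n.+2%:R : R) <= - n.+2%:R^-1.
  rewrite (_ : _ / _ = 1 + - n.+2%:R^-1); last first.
    by rewrite -(natr1 n.+1); field; rewrite gt_eqF//; have := ler0n R n; lra.
  by apply: le_ln1Dx; rewrite ltrN2 invf_lt1// ltr1n.
rewrite !ln_div ?posrE//; move: (ln n.+1%:R) (ln n.+2%:R) (_^-1) => u v z; lra.
Qed.

(** Telescoping replaces the integral test: by [powR_shift_lower], each term [x^(-1-a)] is at most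
    [((x-1)^(-a) - x^(-a)) / a]. *)
Lemma is_cvg_series_powR a : 0 < a ->
  cvgn (series (fun n => n.+1%:R `^ (- (1 + a)) : R)).
Proof.
move=> a0; apply: nondecreasing_is_cvgn.
  apply/nondecreasing_seqP => n; rewrite /series /= big_nat_recr//= lerDl.
  exact: powR_ge0.
exists (1 + a^-1) => _ [[|n] _ <-]; rewrite /series/=.
  by rewrite big_geq// addr_ge0// invr_ge0 ltW.
have : \sum_(0 <= k < n.+1) k.+1%:R `^ (- (1 + a)) <=
       1 + (1 - n.+1%:R `^ (- a)) / a.
  elim: n => [|n IH]; first by rewrite big_nat1 !powR1 subrr mul0r addr0.
  rewrite big_nat_recr//=; apply: le_trans (lerD IH (lexx _)) _.
  have x0 : 0 < n.+2%:R :> R by rewrite ltr0n.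
  have -> : n.+2%:R `^ (- (1 + a)) = n.+2%:R `^ (- a) / n.+2%:R.
    by rewrite -(powR_inv1 (ltW x0)) -gt0_powRD// opprD addrC.
  have := powR_shift_lower n a0.
  set y := n.+2%:R `^ _; set z := n.+1%:R `^ _ => h.
  have h2 : y / n.+2%:R <= (z - y) / a.
    by rewrite ler_pdivlMr//; move: h; rewrite mulrDr mulr1 -mulrAC -mulrA lerBrDl.
  have -> : (1 - y) / a = (1 - z) / a + (z - y) / a by ring.
  by rewrite -addrA !lerD2l.
by move=> /le_trans; apply; rewrite lerD2l ler_pdivrMr// mulVf ?gt_eqF//.
Qed.

(** The lower bound is [ln (1 + t) <= t] at [t = -x/(1+x)], which gives
    [ln (1+x) >= x/(1+x) >= x - x^2]. *)
Lemma ln1D_approx x : 0 <= x -> `|ln (1 + x) - x| <= x ^+ 2.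
Proof.
move=> x0; have x1 : 0 < 1 + x by lra.
have up : ln (1 + x) <= x by apply: le_ln1Dx; lra.
have lo : ln (1 + - (x / (1 + x))) <= - (x / (1 + x)).
  by apply: le_ln1Dx; rewrite ltrN2 ltr_pdivrMr//; lra.
have E : 1 + - (x / (1 + x)) = (1 + x)^-1 by field; lra.
rewrite E lnV ?posrE// in lo.
have F : x - x ^+ 2 <= x / (1 + x) by rewrite ler_pdivlMr//; nra.
by rewrite /= ler_norml; apply/andP; split; lra.
Qed.

(** For [phi k <= n < phi k.+1], monotonicity traps [u n / v n] between [u (phi k) / v (phi k.+1)]
    and [u (phi k.+1) / v (phi k)]; both tend to [l] because consecutive values of [v] along [phi]
    have ratio tending to 1. *)
Lemma cvg_subseq_sandwich (u v : nat -> R) (phi : nat -> nat) (l : R) :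
  (forall n, 0 <= u n) -> {homo u : m n / (m <= n)%N >-> m <= n} ->
  (forall n, (0 < n)%N -> 0 < v n) -> {homo v : m n / (m <= n)%N >-> m <= n} ->
  phi 0 = 1%N -> {homo phi : m n / (m < n)%N} ->
  (fun k => v (phi k.+1) / v (phi k)) @ \oo --> (1 : R) ->
  (fun k => u (phi k) / v (phi k)) @ \oo --> l ->
  (fun n => u n / v n) @ \oo --> l.
Proof.
move=> u0 ui v0 vi phi1 phii vr ul.
have phim : {homo phi : m n / (m <= n)%N}.
  by move=> m n; rewrite leq_eqVlt => /predU1P[->//|/phii/ltnW].
have phip k : (0 < phi k)%N by rewrite -phi1 phim.
have vp k : 0 < v (phi k) by exact: v0.
have phik k : (k < phi k)%N.
  by elim: k => [|k IH]; rewrite ?phi1// (leq_ltn_trans IH)// phii.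
have lo : (fun k => u (phi k) / v (phi k.+1)) @ \oo --> l.
  rewrite (_ : (fun k => _) =
    (fun k => u (phi k) / v (phi k) * (v (phi k.+1) / v (phi k))^-1)); last first.
    by apply/funext => k; field; rewrite !gt_eqF.
  by rewrite -[l]divr1; apply: cvgM => //; apply: cvgV => //; exact: oner_neq0.
have hi : (fun k => u (phi k.+1) / v (phi k)) @ \oo --> l.
  rewrite (_ : (fun k => _) =
    (fun k => u (phi k.+1) / v (phi k.+1) * (v (phi k.+1) / v (phi k)))); last first.
    by apply/funext => k; field; rewrite !gt_eqF.
  rewrite -[l]mulr1; apply: cvgM => //.
  by move: ul; rewrite -cvg_shiftS.
apply/cvgrPdist_le => e e0.
move/cvgrPdist_le : lo => /(_ _ e0)[K1 _ h1].
move/cvgrPdist_le : hi => /(_ _ e0)[K2 _ h2].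
exists (phi (maxn K1 K2)) => // n /= hn.
(* The block containing [n]: the largest [k] with [phi k <= n], which exists since
   [phi 0 = 1 <= n]. *)
have [k /andP[kn nk]] : exists k, (phi k <= n < phi k.+1)%N.
  have exP : exists k, (phi k <= n)%N.
    by exists 0%N; rewrite phi1 (leq_trans _ hn).
  have ub k : (phi k <= n)%N -> (k <= n)%N.
    by move=> h; apply: ltnW; exact: leq_trans h.
  case: (ex_maxnP exP ub) => k kn kmax; exists k; rewrite kn ltnNge.
  by apply/negP => /kmax; rewrite ltnn.
have Kk : (maxn K1 K2 <= k)%N.
  by rewrite leqNgt; apply/negP => /phim /(leq_trans nk); rewrite ltnNge hn.
have n0 : (0 < n)%N by exact: leq_trans kn.
have := h1 k (leq_trans (leq_maxl _ _) Kk).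
have := h2 k (leq_trans (leq_maxr _ _) Kk).
rewrite /= !ler_norml => /andP[b2 _] /andP[_ b1].
have c1 : u (phi k) / v (phi k.+1) <= u n / v n.
  apply: ler_pM; [exact: u0|by rewrite invr_ge0 ltW|exact: ui|].
  by rewrite lef_pV2 ?posrE ?v0// vi// ltnW.
have c2 : u n / v n <= u (phi k.+1) / v (phi k).
  apply: ler_pM; [exact: u0|by rewrite invr_ge0 ltW ?v0|exact/ui/ltnW|].
  by rewrite lef_pV2 ?posrE ?v0// vi.
by apply/andP; split; lra.
Qed.

Lemma ln_natS_cvg : (fun k => ln k.+2%:R - ln k.+1%:R : R) @ \oo --> (0 : R).
Proof.
apply: (@squeeze_cvgr _ _ _ _ (fun=> 0) (fun k => k.+1%:R^-1 : R)).
- near=> k; rewrite -ln_div ?posrE//.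
  rewrite (_ : _ / _ = 1 + k.+1%:R^-1 :> R); last first.
    by rewrite -(addn1 k.+1) natrD mulrDl divff ?pnatr_eq0// mul1r.
  by rewrite ln_ge0 ?lerDl ?invr_ge0//= le_ln1Dx// (lt_le_trans (_ : _ < 0))// ?ltrN10.
- exact: cvg_cst.
- exact: cvg_harmonic.
Unshelve. all: by end_near. Qed.

(** The ratio is [exp (a N (ln (k+2) - ln (k+1)))]. This is why the subsequence grows polynomially:
    for a geometric one the ratio would not tend to 1. *)
Lemma powR_expn_ratio_cvg a (N : nat) :
  (fun k => (k.+2 ^ N)%:R `^ a / (k.+1 ^ N)%:R `^ a : R) @ \oo --> (1 : R).
Proof.
rewrite (_ : (fun k => _) =
  (fun k => expR (a * N%:R * (ln k.+2%:R - ln k.+1%:R)))); last first.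
  apply/funext => k; rewrite /powR !pnatr_eq0 !expn_eq0/= -expRN -expRD !natrX.
  by rewrite !lnXn ?ltr0n//; congr expR;
    rewrite -[X in _ * X - _]mulr_natl -[X in _ - _ * X]mulr_natl; ring.
have h : (fun k => a * N%:R * (ln k.+2%:R - ln k.+1%:R)) @ \oo --> a * N%:R * 0.
  by apply: cvgM; [exact: cvg_cst|exact: ln_natS_cvg].
rewrite mulr0 in h.
have := continuous_cvg _ (@continuous_expR R 0) h; rewrite expR0; exact.
Qed.

End PowerAsymptotics.

(** * Comparison of the growth product with a power of n *)

Section GrowthAsymptotics.
Context {R : realType}.
Variables (pn : nat -> R) (p beta : R).
Hypothesis pn01 : forall n, (1 <= n)%N -> 0 < pn n < 1.
Hypotheses (p0 : 0 <= p) (p1 : p < 1) (beta0 : 0 < beta).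
Hypothesis pn_p : exists (M : R) (N : nat), forall n, (N <= n)%N ->
  `|pn n - p| <= M * (n%:R `^ (- beta)).

(** The finitely many early indices are absorbed by adding their values [|pn j - p| j^beta] to the
    constant. *)
Lemma pn_bound : exists2 M : R, 0 <= M & forall n, (0 < n)%N ->
  `|pn n - p| <= M * n%:R `^ (- beta).
Proof.
have [M [N h]] := pn_p.
pose t j : R := `|pn j - p| * j%:R `^ beta.
have t0 j : 0 <= t j by rewrite mulr_ge0 ?powR_ge0.
exists (`|M| + \sum_(j < N) t j) => [|n n0]; first by rewrite addr_ge0 ?sumr_ge0.
have [Nn|nN] := leqP N n.
  apply: (le_trans (h n Nn)); rewrite ler_wpM2r ?powR_ge0//.
  by rewrite (le_trans (ler_norm _))// lerDl sumr_ge0.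
have -> : `|pn n - p| = t n * n%:R `^ (- beta).
  by rewrite /t -mulrA -gt0_powRD ?ltr0n// subrr powRr0 mulr1.
rewrite ler_wpM2r ?powR_ge0// (bigD1 (Ordinal nN))//= addrCA lerDl.
by rewrite addr_ge0 ?sumr_ge0.
Qed.

Let lg n : R := ln (growth pn 1 n.+1) - (1 - p) * ln n.+1%:R.

Let growth_pos n : 0 < growth pn 1 n.
Proof. by apply: growth_gt0 => //; lra. Qed.

(** The increments of [lg] are [ln (1+y) - (1-p) ln (1+x)] with [x = 1/(n+1)] and
    [y = (1 - pn (n+1)) x]; their linear parts nearly cancel, so they are absolutely summable. *)
Lemma is_cvg_ln_growth : cvgn lg.
Proof.
have [M M0 hM] := pn_bound.
have c2 := is_cvg_series_powR (@ltr01 R).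
have cb := is_cvg_series_powR beta0.
suff /cvg_ex[l hl] : cvgn (series (telescope lg)).
  rewrite telescopeK in hl; apply/cvg_ex; exists (l + lg 0%N).
  suff : (fun n => (lg n - lg 0%N) + lg 0%N) @ \oo --> l + lg 0%N.
    by under eq_fun do rewrite subrK.
  by apply: cvgD => //; exact: cvg_cst.
apply: normed_cvg.
(* The two linearised logarithms cost at most [x^2] each; the remaining [|pn - p| x] is at most
   [M x^(1+beta)]. *)
apply: (@series_le_cvg _ _ (fun n => 2 * n.+1%:R `^ (- (1 + 1)) +
    M * n.+1%:R `^ (- (1 + beta)))) => //.
- by move=> n /=.
- by move=> n /=; rewrite addr_ge0// mulr_ge0// powR_ge0.
- move=> n; rewrite /telescope /lg /= growthS// lnM ?posrE//; last first.
    by apply: growth_factor_gt0 => //; lra.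
  have j0 : 0 < n.+1%:R :> R by rewrite ltr0n.
  have e2 : ln n.+2%:R = ln n.+1%:R + ln (1 + n.+1%:R^-1) :> R.
    rewrite -lnM ?posrE ?addr_gt0 ?invr_gt0//.
    by rewrite mulrDr mulr1 divff ?gt_eqF// natr1.
  rewrite e2 mul1r.
  set y := (1 - pn n.+1) / _; set x := n.+1%:R^-1.
  have x0 : 0 <= x by rewrite invr_ge0 ltW.
  have /andP[q0 q1] := @pn01 n.+1 isT.
  have yE : y = (1 - pn n.+1) * x by [].
  have y0 : 0 <= y by rewrite yE mulr_ge0// subr_ge0 ltW.
  have xP : n.+1%:R `^ (- (1 + 1)) = x ^+ 2 :> R.
    by rewrite opprD gt0_powRD// powR_inv1 ?(ltW j0)// -expr2.
  have xB : n.+1%:R `^ (- (1 + beta)) = x * n.+1%:R `^ (- beta) :> R.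
    by rewrite opprD gt0_powRD// powR_inv1// ltW.
  have := hM n.+1 isT; rewrite xP xB; set b := _ `^ _.
  have := ln1D_approx y0; have := ln1D_approx x0.
  set ly := ln (1 + y); set lx := ln (1 + x).
  have ylex : y ^+ 2 <= x ^+ 2 by rewrite yE exprMn; nra.
  rewrite !ler_norml => /andP[a1 a2] /andP[a3 a4] /andP[a5 a6].
  have p1' : 0 <= 1 - p by rewrite subr_ge0 ltW.
  have := ler_wpM2l p1' a1; have := ler_wpM2l p1' a2.
  have := ler_wpM2l x0 a5; have := ler_wpM2l x0 a6.
  have : 0 <= p * x ^+ 2 by rewrite mulr_ge0 ?sqr_ge0.
  rewrite yE in ylex a3 a4 * => d1 d2 d3 d4 d5.
  by apply/andP; split; lra.
rewrite (_ : series _ = (fun n => 2 * series (fun n => n.+1%:R `^ (- (1 + 1))) n +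
   M * series (fun n => n.+1%:R `^ (- (1 + beta))) n)); last first.
  by apply/funext => n; rewrite /series /= big_split/= -!mulr_sumr.
apply: is_cvgD; apply: is_cvgM => //; exact: is_cvg_cst.
Qed.

Let growthE n : growth pn 1 n.+1 / n.+1%:R `^ (1 - p) = expR (lg n).
Proof.
rewrite /lg expRD expRN lnK ?posrE//; congr (_ / _).
by rewrite /powR pnatr_eq0.
Qed.

Lemma growth_cvg : exists2 l : R, 0 < l &
  (fun n => growth pn 1 n / n%:R `^ (1 - p)) @ \oo --> l.
Proof.
have /cvg_ex[l hl] := is_cvg_ln_growth.
exists (expR l); first exact: expR_gt0.
rewrite -cvg_shiftS; have h := continuous_cvg _ (@continuous_expR R l) hl.
have {}h : (fun n => expR (lg n)) @ \oo --> expR l by exact: h.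
by under eq_fun do rewrite growthE.
Qed.

Lemma growth_lower : exists2 e : R, 0 < e & forall n, (0 < n)%N ->
  e * n%:R `^ (1 - p) <= growth pn 1 n.
Proof.
have [M [_ hM]] := cvg_seq_bounded is_cvg_ln_growth.
exists (expR (- (M + 1))); first exact: expR_gt0.
case=> // n _; rewrite -ler_pdivlMr ?powR_gt0// growthE ler_expR.
have MM : M < M + 1 by rewrite ltrDl.
have /= := hM (M + 1) MM n I.
by rewrite ler_norml => /andP[].
Qed.
End GrowthAsymptotics.

(** * Histories and their probabilities *)

Lemma Cnt_recr (b : nat -> bool) n : Cnt b n.+1 = (Cnt b n + b n)%N.
Proof. by rewrite /Cnt big_ord_recr. Qed.

Lemma Cnt_mono (b : nat -> bool) m n : (m <= n)%N -> (Cnt b m <= Cnt b n)%N.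
Proof.
move=> /subnKC <-; elim: (n - m)%N => [|k IH]; first by rewrite addn0.
by rewrite addnS Cnt_recr (leq_trans IH)// leq_addr.
Qed.

Lemma Kcnt0 (s : nat -> nat) c : Kcnt s 0 c = 0%N.
Proof. by rewrite /Kcnt big_geq. Qed.

Lemma Kcnt_recr (s : nat -> nat) n c :
  Kcnt s n.+1 c = (Kcnt s n c + (s n.+1 == c))%N.
Proof. by rewrite /Kcnt big_nat_recr. Qed.

Lemma Kcnt_mono (s : nat -> nat) c m n :
  (m <= n)%N -> (Kcnt s m c <= Kcnt s n c)%N.
Proof.
move=> /subnKC <-; elim: (n - m)%N => [|k IH]; first by rewrite addn0.
by rewrite addnS Kcnt_recr (leq_trans IH)// leq_addr.
Qed.

Lemma Kcnt_le (s : nat -> nat) n c : (Kcnt s n c <= n)%N.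
Proof.
elim: n => [|n IH]; first by rewrite Kcnt0.
by rewrite Kcnt_recr -addn1 leq_add// leq_b1.
Qed.

Lemma eq_Cnt (b b' : nat -> bool) n :
  (forall i, (i < n)%N -> b i = b' i) -> Cnt b n = Cnt b' n.
Proof. by move=> e; apply: eq_bigr => i _; rewrite e. Qed.

Lemma eq_Kcnt (s s' : nat -> nat) n c :
  (forall i, (i < n)%N -> s i.+1 = s' i.+1) -> Kcnt s n c = Kcnt s' n c.
Proof.
move=> e; apply: eq_big_nat => -[|i] // /andP[_]; rewrite ltnS => ilt.
by rewrite e.
Qed.

(** Contains the support of the path law ([path_prob_admissible]), so the counting facts below apply
    on every cylinder of nonzero probability. *)
Definition admissible (b : nat -> bool) (s : nat -> nat) n :=
  forall i, (i < n)%N ->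
    if b i then s i.+1 = (Cnt b i).+1 else (1 <= s i.+1 <= Cnt b i)%N.

Lemma admissible_range b s n i : admissible b s n -> (i < n)%N ->
  (1 <= s i.+1 <= Cnt b n)%N.
Proof.
move=> adm ilt; have := adm i ilt; have := Cnt_mono b ilt.
by rewrite Cnt_recr; case: (b i) => [|] /=; lia.
Qed.

(** Double counting: each time step registers exactly one label in the range. Hence the total weight
    is [rho * n], a deterministic quantity. *)
Lemma sum_Kcnt b s n : admissible b s n ->
  (\sum_(1 <= c < (Cnt b n).+1) Kcnt s n c)%N = n.
Proof.
move=> adm; rewrite /Kcnt exchange_big /= -[RHS]subn0 -[RHS]subSS.
rewrite -[RHS]muln1 -sum_nat_const_nat; apply: eq_big_nat => -[|i] // /andP[_].
rewrite ltnS => ilt; have r := admissible_range adm ilt.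
rewrite (bigD1_seq (s i.+1)) ?iota_uniq//= ?mem_index_iota//.
by rewrite eqxx big1 // => j /negPf; rewrite eq_sym => ->.
Qed.

(** A label in range either was present one step earlier or is the one just introduced and
    registered. *)
Lemma Kcnt_gt0 b s n c : admissible b s n -> (1 <= c <= Cnt b n)%N ->
  (0 < Kcnt s n c)%N.
Proof.
elim: n => [|n IH] adm; first by rewrite /Cnt big_ord0; lia.
rewrite Kcnt_recr Cnt_recr => hc.
have [hn|hn] := leqP c (Cnt b n).
  by rewrite ltn_addr// IH// => [i ilt|]; [apply: adm; lia|lia].
have := adm n (ltnSn n); case: (b n) hc => [|] /=; last by lia.
by move=> hc ->; rewrite (_ : _ == _) ?addn1//; lia.
Qed.

Section PathProb.
Variables (R : realType) (F : R -> R) (pn : nat -> R).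

Lemma path_prob_recr n b s : path_prob F pn n.+1 b s =
  path_prob F pn n b s * (bern_factor pn b n.+1 * draw_factor F b s n.+1).
Proof. by rewrite /path_prob big_nat_recr. Qed.

Lemma eq_path_prob n b s b' s' :
  (forall i, (i < n)%N -> b i = b' i) ->
  (forall i, (i < n)%N -> s i.+1 = s' i.+1) ->
  path_prob F pn n b s = path_prob F pn n b' s'.
Proof.
move=> eb es; apply: eq_big_nat => -[|i] // /andP[_]; rewrite ltnS => ilt.
have n0 : (0 < n)%N by lia.
rewrite /bern_factor /draw_factor /= (eb _ ilt) (eb _ n0) (es _ ilt).
have -> : Cnt b i = Cnt b' i by apply: eq_Cnt => j ?; rewrite eb//; lia.
have K c : Kcnt s i c = Kcnt s' i c by apply: eq_Kcnt => j ?; rewrite es//; lia.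
by rewrite K; under eq_bigr do rewrite K.
Qed.

Lemma path_prob_admissible n b s : path_prob F pn n b s != 0 -> admissible b s n.
Proof.
elim: n => [|n IH]; first by [].
rewrite path_prob_recr !mulf_eq0 !negb_or => /and3P[/IH adm _ dr] i.
rewrite ltnS leq_eqVlt => /predU1P[->|]; last exact: adm.
move: dr; rewrite /draw_factor /=; case: (b n) => [|].
  by case: ifPn => [/eqP//|_]; rewrite eqxx.
by case: ifPn => //; rewrite eqxx.
Qed.
End PathProb.

(** * Cylinder events and the conditional law of the next draw *)

Section Urn.
Context {R : realType} {d : measure_display} {T : measurableType d}.
Variables (P : probability T R) (rho : R) (pn : nat -> R).
Variables (B : nat -> T -> bool) (S : nat -> T -> nat).
Hypothesis rho0 : 0 < rho.
Hypothesis urn : is_triggered_urn P (fun x => rho * x) pn B S.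

Let mB i v : measurable [set w | B i w = v]. Proof. exact: urn.1. Qed.
Let mS i k : measurable [set w | S i w = k]. Proof. exact: urn.2.1. Qed.

Definition cylinder n (b : nat -> bool) (s : nat -> nat) :=
  [set w : T | forall i, (i < n)%N -> B i w = b i /\ S i.+1 w = s i.+1].

(** The atom containing [w0] of the sigma-algebra generated by the first [n] steps. *)
Definition atom n w0 := cylinder n (B^~ w0) (S^~ w0).

Lemma cylinderS n b s : cylinder n.+1 b s =
  cylinder n b s `&` ([set w | B n w = b n] `&` [set w | S n.+1 w = s n.+1]).
Proof.
apply/seteqP; split => w /= h.
  by split=> [i ilt|]; [apply: h; lia|exact: h].
by move=> i; rewrite ltnS leq_eqVlt => /predU1P[->|/h.1//]; exact: h.2.
Qed.

Lemma measurable_cylinder n b s : measurable (cylinder n b s).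
Proof.
elim: n => [|n IH]; last first.
  by rewrite cylinderS; apply: measurableI => //; apply: measurableI.
by rewrite (_ : cylinder 0 b s = setT)//; apply/seteqP.
Qed.

Lemma prob_cylinder n b s :
  P (cylinder n b s) = (path_prob (fun x => rho * x) pn n b s)%:E.
Proof. exact: urn.2.2. Qed.

(** Split on [B n]. A trigger registers the new label [Cnt b n + 1], which is not [c]; otherwise [c]
    is drawn with probability [rho K / (rho n)] by [sum_Kcnt]. *)
Lemma prob_cylinder_draw n b s c : (0 < n)%N -> (1 <= c <= Cnt b n)%N ->
  P (cylinder n b s `&` [set w | S n.+1 w = c]) =
  (((1 - pn n) * (Kcnt s n c)%:R / n%:R)%:E * P (cylinder n b s))%E.
Proof.
move=> n0 hc.
(* The prefix prolonged by one step, with [B n = v] and [S n.+1 = c]; the first [n] steps are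
   unchanged. *)
pose b' v i := if i == n then v else b i.
pose s' i := if i == n.+1 then c else s i.
have E v : cylinder n b s `&` [set w | S n.+1 w = c] `&` [set w | B n w = v] =
           cylinder n.+1 (b' v) s'.
  rewrite cylinderS /b' /s' !eqxx -setIA [X in _ `&` X]setIC.
  congr (_ `&` _); apply/seteqP; split=> w /= h i ilt; have := h i ilt;
  by rewrite eqSS (ltn_eqF ilt).
rewrite -[X in P X]setIT
  (_ : setT = [set w | B n w = true] `|` [set w | B n w = false]); last first.
  by apply/seteqP; split => w //= _; case: (B n w); [left|right].
have -> : P (cylinder n b s `&` [set w | S n.+1 w = c] `&`
    ([set w | B n w = true] `|` [set w | B n w = false])) =
    (P (cylinder n.+1 (b' true) s') + P (cylinder n.+1 (b' false) s'))%E.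
  rewrite setIUr !E; apply: measureU; [exact: measurable_cylinder..|].
  by rewrite -!E; apply/seteqP; split => w //= [[_ ->] [_]].
have pE v : path_prob (fun x => rho * x) pn n (b' v) s' =
            path_prob (fun x => rho * x) pn n b s.
  by apply: eq_path_prob => i ilt; rewrite /b' /s' ?eqSS (ltn_eqF ilt).
have CE v : Cnt (b' v) n = Cnt b n.
  by apply: eq_Cnt => i ilt; rewrite /b' (ltn_eqF ilt).
have KE k : Kcnt s' n k = Kcnt s n k.
  by apply: eq_Kcnt => i ilt; rewrite /s' eqSS (ltn_eqF ilt).
rewrite !prob_cylinder !path_prob_recr !pE -EFinD -EFinM; congr (_%:E).
have [->|p0] := eqVneq (path_prob (fun x => rho * x) pn n b s) 0.
  by rewrite !mul0r mulr0 addr0.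
have adm := path_prob_admissible p0.
rewrite /bern_factor /draw_factor /= gtn_eqF// !CE {1 4}/b' !eqxx /=.
rewrite {1 2 3}/s' !eqxx [_ == _](_ : _ = false); last by lia.
rewrite /b' /s' !eqxx KE.
under eq_bigr do rewrite KE.
rewrite -mulr_sumr -natr_sum sum_Kcnt//.
have n0' : n%:R != 0 :> R by rewrite pnatr_eq0; lia.
by rewrite !mulr0 add0r hc; field; rewrite n0' gt_eqF.
Qed.

Lemma prob_cylinder_gt0 n b s : P (cylinder n b s) != 0%E -> admissible b s n.
Proof. by rewrite prob_cylinder eqe => /path_prob_admissible. Qed.

(** * Martingales of the urn *)

(** Measurability with respect to the first [n] steps, expressed as constancy on atoms. *)
Definition adapted (U : Type) n (f : T -> U) :=
  forall w0 w, atom n w0 w -> f w = f w0.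

Lemma atom_mono m n w0 w : (m <= n)%N -> atom n w0 w -> atom m w0 w.
Proof. by move=> mn h i im; apply: h; exact: leq_trans mn. Qed.

Lemma adapted_mono U m n (f : T -> U) : (m <= n)%N ->
  adapted m f -> adapted n f.
Proof. by move=> mn fa w0 w /(atom_mono mn); exact: fa. Qed.

Lemma adapted_Cnt n : adapted n (fun w => Cnt (B^~ w) n).
Proof. by move=> w0 w h; apply: eq_Cnt => i /h[]. Qed.

Lemma adapted_Kcnt n c : adapted n (fun w => Kcnt (S^~ w) n c).
Proof. by move=> w0 w h; apply: eq_Kcnt => i /h[]. Qed.

(* The atoms of the first n steps, reindexed by nat (some cells are empty) so
   that countable additivity over sequences of sets applies. *)
Definition cell n k := [set w | pickle (mkseq (fun i => (B i w, S i.+1 w)) n) = k].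

Lemma cell_atom n w0 :
  cell n (pickle (mkseq (fun i => (B i w0, S i.+1 w0)) n)) = atom n w0.
Proof.
apply/seteqP; split => w /=.
  move=> /(pcan_inj pickleK) e i ilt.
  have := congr1 (fun s => nth (false, 0%N) s i) e.
  by rewrite !nth_mkseq// => -[].
move=> h; congr pickle; apply/eq_in_map => i.
by rewrite mem_iota /= => /h[-> ->].
Qed.

Lemma cellP n k : cell n k = set0 \/ exists w0, cell n k = atom n w0.
Proof.
have [e|/set0P[w0 <-]] := eqVneq (cell n k) set0; first by left.
by right; exists w0; exact: cell_atom.
Qed.

Lemma measurable_atom n w0 : measurable (atom n w0).
Proof. exact: measurable_cylinder. Qed.

Lemma measurable_cell n k : measurable (cell n k).
Proof. by case: (cellP n k) => [->//|[w0 ->]]; exact: measurable_atom. Qed.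

Lemma bigcup_cell n : \bigcup_k cell n k = setT.
Proof. by apply/seteqP; split => // w _; eexists. Qed.

(** Each of the countably many cells lies inside the preimage or is disjoint from it. *)
Lemma measurable_adapted n (U : Type) (f : T -> U) (Y : set U) :
  adapted n f -> measurable (f @^-1` Y).
Proof.
move=> fa; rewrite -[X in measurable X]setIT -(bigcup_cell n) setI_bigcupr.
apply: bigcupT_measurable => k; case: (cellP n k) => [->|[w0 ->]].
  by rewrite setI0.
have [Yf|Yf] := pselect (Y (f w0)).
  rewrite (_ : _ `&` _ = atom n w0); first exact: measurable_atom.
  by apply/seteqP; split => [w []//|w h]; split => //=; rewrite (fa _ _ h).
rewrite (_ : _ `&` _ = set0)//; apply/seteqP; split => w //= [+ h].
by rewrite (fa _ _ h).
Qed.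

Lemma measurable_fun_adapted n d' (U : measurableType d') (f : T -> U) :
  adapted n f -> measurable_fun setT f.
Proof. by move=> fa _ Y _; rewrite setTI; exact: measurable_adapted fa. Qed.

Lemma integrable_adapted n (f : T -> R) (M : R) :
  adapted n f -> (forall w, `|f w| <= M) -> P.-integrable setT (EFin \o f).
Proof.
move=> fa fM; apply: measurable_bounded_integrable => //.
- exact: le_lt_trans (probability_le1 P measurableT) (ltry _).
- exact: measurable_fun_adapted fa.
- exists M; split; first exact: num_real.
  by move=> x Mx w _; exact: le_trans (ltW Mx).
Qed.

(** Countable additivity over cells; this stands in for conditioning on the first [n] steps. *)
Lemma eq_integral_atom (n : nat) (f g : T -> \bar R) :
  measurable_fun setT f -> measurable_fun setT g ->
  (forall w, 0 <= f w)%E -> (forall w, 0 <= g w)%E ->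
  (forall w0, \int[P]_(w in atom n w0) f w = \int[P]_(w in atom n w0) g w)%E ->
  (\int[P]_w f w = \int[P]_w g w)%E.
Proof.
move=> mf mg f0 g0 fg; rewrite -(bigcup_cell n).
have tc : trivIset setT (cell n) by move=> i j _ _ [w [/= <- <-]].
rewrite !ge0_integral_bigcup ?bigcup_cell//; try exact: measurable_cell.
apply: eq_eseriesr => k _; case: (cellP n k) => [->|[w0 ->]]; last exact: fg.
by rewrite !integral_set0.
Qed.

(** * The one-step martingale identity *)

Section Step.
Variables (c n : nat) (g : nat -> R) (lam : R) (H : T -> R).
Hypotheses (n0 : (0 < n)%N) (c0 : (0 < c)%N).
Hypotheses (g0 : forall k, 0 <= g k).
Hypothesis geig : forall k, (0 < k)%N -> k%:R * (g k.+1 - g k) = lam * g k.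
Hypothesis lam0 : 0 <= 1 + lam * (1 - pn n) / n%:R.
Hypotheses (Ha : adapted n H) (H0 : forall w, 0 <= H w).
Hypothesis Hc : forall w, (Cnt (B^~ w) n < c)%N -> H w = 0.

Let K m w := Kcnt (S^~ w) m c.

Let adapted_gKH m : (n <= m)%N -> adapted m (fun w => g (K m w) * H w).
Proof.
move=> nm w0 w h; rewrite (adapted_mono nm Ha h) /K.
by have /= -> := @adapted_Kcnt m c _ _ h.
Qed.

(** On an atom where [c] is present, the mean of [g (K n.+1)] is
    [g K + (1 - pn n) (K/n) (g (K+1) - g K)], and [geig] turns this into a multiple of [g K]. The
    weight [H] is constant on atoms and removes those where [c] is absent. *)
Lemma integral_step : (\int[P]_w (g (K n.+1 w) * H w)%:E =
  \int[P]_w ((1 + lam * (1 - pn n) / n%:R) * (g (K n w) * H w))%:E)%E.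
Proof.
have gH0 m w : 0 <= g (K m w) * H w by rewrite mulr_ge0.
apply: (@eq_integral_atom n).
- apply/measurable_EFinP; apply: (@measurable_fun_adapted n.+1).
  exact: adapted_gKH.
- apply/measurable_EFinP; apply: measurable_funM => //.
  by apply: (@measurable_fun_adapted n); exact: adapted_gKH.
- by move=> w; rewrite lee_fin.
- by move=> w; rewrite lee_fin mulr_ge0.
move=> w0; have mA := measurable_atom n w0.
have [cn|nc] := ltnP (Cnt (B^~ w0) n) c.
  have E0 w : w \in atom n w0 -> H w = 0.
    by move=> /set_mem h; rewrite (Ha h) Hc.
  by apply: eq_integral => w /E0 ->; rewrite !mulr0.
rewrite [RHS](eq_integral (cst (((1 + lam * (1 - pn n) / n%:R) *
    (g (K n w0) * H w0))%:E))); last first.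
  by move=> w /set_mem h; rewrite /= (@adapted_gKH n (leqnn n) _ _ h).
rewrite integral_cst//.
pose Q := [set w | S n.+1 w = c].
have mQ : measurable Q by exact: mS.
have -> : atom n w0 = (atom n w0 `&` Q) `|` (atom n w0 `\` Q).
  by rewrite setUIDK.
rewrite ge0_integral_setU//; first last.
- by apply/disj_setPS => w /= [[_ q] [_]]; exact.
- by move=> w _; rewrite lee_fin.
- apply/measurable_EFinP; apply: measurable_funTS.
  by apply: (@measurable_fun_adapted n.+1); exact: adapted_gKH.
- exact: measurableD.
- exact: measurableI.
rewrite (eq_integral (cst (g (K n w0).+1 * H w0)%:E)); last first.
  move=> w /set_mem [h q]; rewrite /= (Ha h) /K Kcnt_recr q eqxx addn1.
  by have /= -> := @adapted_Kcnt n c _ _ h.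
rewrite [X in (_ + X)%E](eq_integral (cst (g (K n w0) * H w0)%:E)); last first.
  move=> w /set_mem [h /eqP/negPf q]; rewrite /= (Ha h) /K Kcnt_recr q addn0.
  by have /= -> := @adapted_Kcnt n c _ _ h.
rewrite !integral_cst//; [|exact: measurableD|exact: measurableI].
rewrite setUIDK [X in (_ + _ * X)%E]measureD//; last first.
  by rewrite (le_lt_trans (probability_le1 _ _))// ltry.
have cc : (1 <= c <= Cnt (B^~ w0) n)%N by rewrite c0.
have PQ : P (atom n w0 `&` Q) = _ := prob_cylinder_draw (S^~ w0) n0 cc.
have PA : P (atom n w0) = _ := prob_cylinder n (B^~ w0) (S^~ w0).
have := @prob_cylinder_gt0 n (B^~ w0) (S^~ w0).
rewrite -/(atom n w0) in PQ *; rewrite PA in PQ *.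
rewrite [X in (_ * X + _)%E]PQ [X in (_ * (_ - X))%E]PQ.
rewrite [X in (_ * (X - _))%E]PA [X in _ = (_ * X)%E]PA => adm.
rewrite -!EFinM -EFinD; congr (_%:E).
set x := path_prob _ _ _ _ _ in adm *.
(* Null atoms contribute nothing; on the others the history is admissible, so [K n w0 > 0] and
   [geig] applies. *)
have [->|x0] := eqVneq x 0; first by ring.
have K0 : (0 < K n w0)%N.
  by apply: (@Kcnt_gt0 (B^~ w0)); [apply: adm; rewrite eqe|rewrite c0].
have := geig K0; rewrite -/(K n w0).
have n0' : n%:R != 0 :> R by rewrite pnatr_eq0; lia.
set k := (K n w0)%:R => e.
transitivity (g (K n w0) * H w0 * x +
    (1 - pn n) / n%:R * H w0 * x * (k * (g (K n w0).+1 - g (K n w0)))).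
  by field.
by rewrite e; field.
Qed.
End Step.

(** The class of integrands used for the martingales: closed under the algebraic operations and
    always integrable, since counts at time [n] are at most [n]. *)
Definition bounded_adapted (f : T -> R) :=
  exists n M, adapted n f /\ forall w, `|f w| <= M.

Lemma bounded_adapted_integrable f : bounded_adapted f ->
  P.-integrable setT (EFin \o f).
Proof. by move=> [n [M [fa fM]]]; exact: integrable_adapted fa fM. Qed.

Lemma bounded_adaptedZ r f : bounded_adapted f ->
  bounded_adapted (fun w => r * f w).
Proof.
move=> [n [M [fa fM]]]; exists n, (`|r| * M); split.
  by move=> w0 w /fa ->.
by move=> w; rewrite normrM ler_wpM2l.
Qed.

Lemma bounded_adaptedD f g : bounded_adapted f -> bounded_adapted g ->
  bounded_adapted (fun w => f w + g w).
Proof.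
move=> [m [M [fa fM]]] [n [N [ga gN]]]; exists (maxn m n), (M + N); split.
  move=> w0 w h; rewrite (adapted_mono (leq_maxl _ _) fa h).
  by rewrite (adapted_mono (leq_maxr _ _) ga h).
by move=> w; rewrite (le_trans (ler_normD _ _))// lerD.
Qed.

Lemma bounded_adaptedM f g : bounded_adapted f -> bounded_adapted g ->
  bounded_adapted (fun w => f w * g w).
Proof.
move=> [m [M [fa fM]]] [n [N [ga gN]]]; exists (maxn m n), (M * N); split.
  move=> w0 w h; rewrite (adapted_mono (leq_maxl _ _) fa h).
  by rewrite (adapted_mono (leq_maxr _ _) ga h).
by move=> w; rewrite normrM ler_pM.
Qed.

Lemma RintegralD_ba f g : bounded_adapted f -> bounded_adapted g ->
  \int[P]_w (f w + g w) = \int[P]_w f w + \int[P]_w g w.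
Proof.
by move=> /bounded_adapted_integrable fi /bounded_adapted_integrable gi;
  rewrite RintegralD.
Qed.

Lemma RintegralZ_ba r f : bounded_adapted f ->
  \int[P]_w (r * f w) = r * \int[P]_w f w.
Proof. by move=> /bounded_adapted_integrable fi; rewrite RintegralZl. Qed.

Lemma le_Rintegral_ba f g : bounded_adapted f -> bounded_adapted g ->
  (forall w, f w <= g w) -> \int[P]_w f w <= \int[P]_w g w.
Proof.
move=> /bounded_adapted_integrable fi /bounded_adapted_integrable gi fg.
exact: le_Rintegral.
Qed.

Hypothesis pn01 : forall n, (1 <= n)%N -> 0 < pn n < 1.

(** * Martingale identities and moment bounds for one color *)

Section Martingale.
Variable c : nat.
Hypothesis c0 : (0 < c)%N.
Let K n w := Kcnt (S^~ w) n c.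

Definition present m w : R := (c <= Cnt (B^~ w) m)%:R.

Lemma bounded_adapted_Kcnt n g : bounded_adapted (fun w => g (K n w)).
Proof.
exists n, (\sum_(k < n.+1) `|g k|); split.
  by move=> w0 w h; rewrite /K; have /= -> := @adapted_Kcnt n c _ _ h.
move=> w; have kn : (K n w < n.+1)%N by rewrite ltnS Kcnt_le.
by rewrite (bigD1 (Ordinal kn))//= lerDl sumr_ge0.
Qed.

Lemma bounded_adapted_present m : bounded_adapted (present m).
Proof.
exists m, 1; split.
  by move=> w0 w h; rewrite /present; have /= -> := @adapted_Cnt m _ _ h.
by move=> w; rewrite ger0_norm// lern1 leq_b1.
Qed.

(** Iterates [integral_step], whose factors multiply up to [growth]. Allowing every weight [H] fixed
    at time [m] expresses the martingale property from time [m] on. *)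
Lemma martingale lam g m n (H : T -> R) : -1 <= lam ->
  (forall k, 0 <= g k) ->
  (forall k, (0 < k)%N -> k%:R * (g k.+1 - g k) = lam * g k) ->
  (0 < m <= n)%N -> adapted m H -> bounded_adapted H -> (forall w, 0 <= H w) ->
  (forall w, (Cnt (B^~ w) m < c)%N -> H w = 0) ->
  \int[P]_w (g (K n w) / growth pn lam n * H w) =
  \int[P]_w (g (K m w) / growth pn lam m * H w).
Proof.
move=> lam1 g0 geig /andP[m0 /subnKC <-] Ha Hb H0 Hc.
elim: (n - m)%N => [|k <-]; first by rewrite addn0.
rewrite addnS; set l := (m + k)%N; have l0 : (0 < l)%N by rewrite /l; lia.
have gp j := growth_gt0 pn01 j lam1.
have fp := growth_factor_gt0 pn01 lam1 l0.
have ba j : bounded_adapted (fun w => g (K j w) * H w).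
  by apply: bounded_adaptedM => //; exact: bounded_adapted_Kcnt.
transitivity (\int[P]_w ((growth pn lam l.+1)^-1 * (g (K l.+1 w) * H w))).
  by apply: eq_Rintegral => w _; ring.
rewrite RintegralZ_ba//.
transitivity (\int[P]_w ((growth pn lam l)^-1 * (g (K l w) * H w))); last first.
  by apply: eq_Rintegral => w _; ring.
rewrite [RHS]RintegralZ_ba// {1}/Rintegral (integral_step (lam := lam))//; last 3 first.
- exact: ltW.
- by apply: adapted_mono Ha; rewrite leq_addr.
- by move=> w h; rewrite Hc// (leq_ltn_trans _ h)// Cnt_mono// leq_addr.
rewrite -/(Rintegral _ _ _) RintegralZ_ba; last exact: ba.
rewrite growthS// /K.
set x := 1 + _ in fp *; set Y := Rintegral _ _ _.
by field; rewrite !gt_eqF.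
Qed.

Let N1 : -1 <= 1 :> R. Proof. by lra. Qed.

Definition scaled n w := (K n w)%:R / growth pn 1 n.

Lemma bounded_adapted_scaled n : bounded_adapted (scaled n).
Proof. exact: (bounded_adapted_Kcnt n (fun k => k%:R / growth pn 1 n)). Qed.

(** Orthogonality of increments reduces the left side to a difference of second moments. Writing
    [K^2 = K (K+1) - K] expresses these through the constant means of the martingales for [lam = 2]
    and [lam = 1]. *)
Lemma scaled_increment m n n' : (0 < m <= n)%N -> (n <= n')%N ->
  \int[P]_w ((scaled n' w - scaled n w) ^+ 2 * present m w) <=
  m%:R / growth pn 1 n.
Proof.
move=> /andP[m0 mn] nn'; have n0 := leq_trans m0 mn.
have I0 w : 0 <= present m w by [].
have Ic w : (Cnt (B^~ w) m < c)%N -> present m w = 0.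
  by move=> h; rewrite /present leqNgt h.
have Ia : adapted m (present m).
  by move=> w0 w h; rewrite /present; have /= -> := @adapted_Cnt m _ _ h.
have Ib := bounded_adapted_present m.
have sb k := bounded_adapted_scaled k.
have s0 k w : 0 <= scaled k w by rewrite divr_ge0// ltW// growth_gt0.
have idE k : (0 < k)%N -> k%:R * (k.+1%:R - k%:R) = 1 * k%:R :> R.
  by move=> _; rewrite -addn1 natrD; ring.
pose N k w : R := ((K k w)%:R * ((K k w)%:R + 1)) / growth pn 2 k.
have Nb k : bounded_adapted (N k).
  exact: (bounded_adapted_Kcnt k (fun i => i%:R * (i%:R + 1) / growth pn 2 k)).
pose rat k := growth pn 2 k / growth pn 1 k ^+ 2.
have sq k w : scaled k w * (scaled k w * present m w) =
    rat k * (N k w * present m w) +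
    - (growth pn 1 k)^-1 * (scaled k w * present m w).
  have h1 := growth_gt0 pn01 k N1.
  have h2 : 0 < growth pn 2 k by apply: growth_gt0 => //; lra.
  by rewrite /rat /N /scaled; field; rewrite !gt_eqF.
have sqI k : \int[P]_w (scaled k w * (scaled k w * present m w)) =
    rat k * \int[P]_w (N k w * present m w) -
    (growth pn 1 k)^-1 * \int[P]_w (scaled k w * present m w).
  rewrite -mulNr -!RintegralZ_ba; try exact: bounded_adaptedM.
  rewrite -RintegralD_ba; try (apply: bounded_adaptedZ; exact: bounded_adaptedM).
  by apply: eq_Rintegral => w _; exact: sq.
have XE k : (m <= k)%N -> \int[P]_w (scaled k w * present m w) =
                          \int[P]_w (scaled m w * present m w).
  by move=> mk; apply: (martingale N1 _ idE); rewrite ?m0.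
have NE k : (m <= k)%N -> \int[P]_w (N k w * present m w) =
                          \int[P]_w (N m w * present m w).
  move=> mk; apply: (@martingale 2 (fun i => i%:R * (i%:R + 1))); rewrite ?m0//.
    by lra.
  by move=> i _ /=; rewrite -addn1 natrD; ring.
(* The martingale identity from [n] to [n'] with weight [scaled n * present m], known at time
   [n]. *)
have cross : \int[P]_w (scaled n' w * (scaled n w * present m w)) =
             \int[P]_w (scaled n w * (scaled n w * present m w)).
  apply: (martingale N1 _ idE); rewrite ?n0//.
  - move=> w0 w h; rewrite (adapted_mono mn Ia h) /scaled /K.
    by have /= -> := @adapted_Kcnt n c _ _ h.
  - exact: bounded_adaptedM.
  - by move=> w; rewrite mulr_ge0.
  - by move=> w h; rewrite Ic ?mulr0// (leq_ltn_trans _ h)// Cnt_mono.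
have sbb k l : bounded_adapted (fun w => scaled k w * (scaled l w * present m w)).
  by apply: bounded_adaptedM => //; exact: bounded_adaptedM.
have -> : \int[P]_w ((scaled n' w - scaled n w) ^+ 2 * present m w) =
    \int[P]_w (scaled n' w * (scaled n' w * present m w)) -
    \int[P]_w (scaled n w * (scaled n w * present m w)).
  transitivity (\int[P]_w (scaled n' w * (scaled n' w * present m w) +
     (-2 * (scaled n' w * (scaled n w * present m w)) +
      scaled n w * (scaled n w * present m w)))).
    by apply: eq_Rintegral => w _; ring.
  rewrite RintegralD_ba//; last first.
    by apply: bounded_adaptedD => //; exact: bounded_adaptedZ.
  rewrite RintegralD_ba//; last exact: bounded_adaptedZ.
  by rewrite RintegralZ_ba// cross; ring.
rewrite !sqI !XE ?NE//; try exact: leq_trans nn'.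
have ratn : rat n' <= rat n by rewrite -(subnKC nn'); exact: growth_ratio_noninc.
have X0 : 0 <= \int[P]_w (scaled m w * present m w).
  by apply: Rintegral_ge0 => w _; rewrite mulr_ge0.
(* Uses [K m <= m] and [growth 1 m >= 1]; this is the source of the numerator [m]. *)
have Xm : \int[P]_w (scaled m w * present m w) <= m%:R.
  apply: (@le_trans _ _ (\int[P]_w (cst m%:R w))).
    apply: le_Rintegral_ba; first exact: bounded_adaptedM.
      by exists 0%N, `|m%:R|.
    move=> w; rewrite /= -[leRHS]mulr1 ler_pM// ?lern1 ?leq_b1//.
    rewrite ler_pdivrMr ?growth_gt0// (le_trans (_ : _ <= m%:R))//.
      by rewrite ler_nat Kcnt_le.
    by rewrite ler_peMr// growth1_ge1.
  rewrite Rintegral_cst// (_ : fine _ = 1) ?mulr1//.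
  by transitivity (fine (1%E : \bar R)) => //; congr fine; exact: probability_setT.
have Y0 : 0 <= \int[P]_w (N m w * present m w).
  apply: Rintegral_ge0 => w _; rewrite mulr_ge0// divr_ge0 ?mulr_ge0//.
  by rewrite ltW// growth_gt0//; lra.
set X := \int[P]_w (scaled m w * _) in X0 Xm *.
set Y := \int[P]_w (N m w * _) in Y0 *.
have g1 := growth_gt0 pn01 n N1; have g1' := growth_gt0 pn01 n' N1.
have i0 : 0 <= (growth pn 1 n)^-1 by rewrite invr_ge0 ltW.
have i0' : 0 <= (growth pn 1 n')^-1 by rewrite invr_ge0 ltW.
nra.
Qed.

(** [C] is the constant mean of the martingale with [lam = -1/2]; [growth_half_bound] compares the
    two normalisations. *)
Lemma negative_moment m : (0 < m)%N -> exists C, forall n, (m <= n)%N ->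
  \int[P]_w (Num.sqrt (growth pn 1 n) * negative_power (K n w) * present m w) <= C.
Proof.
move=> m0; have N2 : -1 <= - 2^-1 :> R by lra.
pose C := \int[P]_w (negative_power (K m w) / growth pn (- 2^-1) m * present m w).
exists C => n mn.
have ba k : bounded_adapted
    (fun w => negative_power (K k w) / growth pn (- 2^-1) k * present m w).
  apply: bounded_adaptedM; last exact: bounded_adapted_present.
  exact: (bounded_adapted_Kcnt k (fun i => negative_power i / growth pn (- 2^-1) k)).
have <- : \int[P]_w (negative_power (K n w) / growth pn (- 2^-1) n * present m w) = C.
  apply: martingale => //; rewrite ?m0//.
  - exact: negative_power_ge0.
  - move=> k k0; rewrite negative_powerS//; field.
    by rewrite pnatr_eq0; lia.
  - by move=> w0 w h; rewrite /present; have /= -> := @adapted_Cnt m _ _ h.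
  - exact: bounded_adapted_present.
  - by move=> w h; rewrite /present leqNgt h.
apply: le_Rintegral_ba => // [|w].
  apply: bounded_adaptedM; last exact: bounded_adapted_present.
  exact: (bounded_adapted_Kcnt n (fun i => Num.sqrt (growth pn 1 n) * negative_power i)).
rewrite ler_wpM2r// mulrC ler_wpM2l ?negative_power_ge0//.
have gh := growth_gt0 pn01 n N2.
rewrite -[leRHS]div1r ler_pdivlMr//.
rewrite -(@ler_pXn2r _ 2) ?nnegrE// ?mulr_ge0// ?sqrtr_ge0// ?(ltW gh)//.
rewrite exprMn sqr_sqrtr ?(ltW (growth_gt0 pn01 n N1))// expr1n.
by rewrite mulrC growth_half_bound.
Qed.
End Martingale.
End Urn.

(** * Almost sure limits *)

Lemma nneseries_EFin_lty (R : realType) (v : nat -> R) : cvgn (series v) ->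
  (\sum_(k <oo) (v k)%:E < +oo)%E.
Proof.
move=> cv; rewrite (_ : (fun n => _) = EFin \o series v); last first.
  by apply/funext => n /=; rewrite -sumEFin.
by rewrite EFin_lim// ltry.
Qed.

Lemma powRN2 (R : realType) k : k.+1%:R `^ (- (1 + 1)) = (k.+1%:R ^+ 2)^-1 :> R.
Proof.
have x0 : 0 < k.+1%:R :> R by rewrite ltr0n.
by rewrite opprD gt0_powRD// powR_inv1 ?(ltW x0)// -invfM.
Qed.

Lemma powR_cvg_infty (R : realType) (q : R) : 0 < q ->
  (fun n => n%:R `^ q : R) @ \oo --> +oo.
Proof.
move=> q0; apply/cvgryPge => A.
exists (Num.bound (`|A| `^ q^-1)) => // n /= hn.
apply: le_trans (ler_norm A) _.
have {1}-> : `|A| = (`|A| `^ q^-1) `^ q.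
  by rewrite -powRrM mulVf ?gt_eqF// powRr1.
apply: ge0_ler_powR; rewrite ?nnegrE ?powR_ge0//; first exact: ltW.
by apply/ltW/(lt_le_trans (archi_boundP (powR_ge0 _ _))); rewrite ler_nat.
Qed.

Section UrnLimit.
Context {R : realType} {d : measure_display} {T : measurableType d}.
Variables (P : probability T R) (rho : R) (pn : nat -> R) (p beta : R).
Variables (B : nat -> T -> bool) (S : nat -> T -> nat).
Hypothesis rho0 : 0 < rho.
Hypothesis pn01 : forall n, (1 <= n)%N -> 0 < pn n < 1.
Hypotheses (p0 : 0 <= p) (p1 : p < 1) (beta0 : 0 < beta).
Hypothesis pn_p : exists (M : R) (N : nat), forall n, (N <= n)%N ->
  `|pn n - p| <= M * (n%:R `^ (- beta)).
Hypothesis urn : is_triggered_urn P (fun x => rho * x) pn B S.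
Variable c : nat.
Hypothesis c0 : (0 < c)%N.

Let q := 1 - p.
Let q0 : 0 < q. Proof. by rewrite subr_gt0. Qed.
Let K n w := Kcnt (S^~ w) n c.
Let Z := scaled pn S c.
Let pres := present B c : nat -> T -> R.

Section Subsequence.
Variable N : nat.
Hypothesis Nq : 4 <= N%:R * q.
Let phi k := (k.+1 ^ N)%N.

Let N0 : (0 < N)%N.
Proof. by rewrite lt0n; apply/negP => /eqP N_0; move: Nq; rewrite N_0 mul0r; lra. Qed.

Let phi_gt k : (k < phi k)%N.
Proof. by rewrite /phi -[k.+1 in X in (X <= _)%N]expn1 leq_pexp2l. Qed.

Let phi_mono : {homo phi : m n / (m < n)%N}.
Proof. by move=> m n mn; rewrite /phi ltn_exp2r. Qed.

(** The exponent 4 is spent in two halves: after weighting by [(k+1)^2], the second moments of the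
    increments are still of order [(k+1)^(-2)], hence summable. *)
Let phi_pow k : k.+1%:R ^+ 4 <= (phi k)%:R `^ q :> R.
Proof.
rewrite /phi natrX -(powR_mulrn N)// -powRrM -powR_mulrn//.
by apply: ler_powR => //; rewrite ler1n.
Qed.

Let incr k w := Z (phi k.+1) w - Z (phi k) w.

Lemma ae_cvg_scaled_subseq m : (0 < m)%N ->
  {ae P, forall w, (c <= Cnt (B^~ w) m)%N -> cvgn (fun k => Z (phi k) w)}.
Proof.
move=> m0; have [e e0 he] := growth_lower pn01 p0 p1 beta0 pn_p.
(* The shift by [m] ensures [phi (k + m) >= m], so the color is already present at the times
   compared. *)
pose X k w := k.+1%:R ^+ 2 * (incr (k + m) w ^+ 2 * pres m w).
have X0 k w : 0 <= X k w.
  apply: mulr_ge0; first exact: sqr_ge0.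
  by apply: mulr_ge0 => //; exact: sqr_ge0.
have Ib k : bounded_adapted B S (fun w => incr (k + m) w ^+ 2 * pres m w).
  apply: bounded_adaptedM; last exact: bounded_adapted_present.
  have Zb j : bounded_adapted B S (Z j) by exact: bounded_adapted_scaled.
  have ib : bounded_adapted B S (incr (k + m)).
    rewrite (_ : incr _ = fun w => Z (phi (k + m).+1) w + -1 * Z (phi (k + m)) w).
      by apply: bounded_adaptedD => //; exact: bounded_adaptedZ.
    by apply/funext => w; rewrite mulN1r.
  exact: (bounded_adaptedM ib ib).
have Xb k : bounded_adapted B S (X k) by exact: bounded_adaptedZ.
have Xi k := bounded_adapted_integrable rho0 urn (Xb k).
have mX k : measurable_fun setT (fun w => (X k w)%:E).
  exact: measurable_int (Xi k).
have IE k : (\int[P]_w (X k w)%:E = (Rintegral P setT (X k))%:E)%E.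
  by rewrite /Rintegral fineK//; exact: (integrable_fin_num measurableT (Xi k)).
have EX k : (\int[P]_w (X k w)%:E <= (m%:R / e * k.+1%:R `^ (- (1 + 1)))%:E)%E.
  rewrite IE lee_fin /X (RintegralZ_ba rho0 urn _ (Ib k)).
  have mphi : (m <= phi (k + m))%N.
    by apply: leq_trans (ltnW (phi_gt _)); rewrite leq_addl.
  have := scaled_increment rho0 urn pn01 c0 (m := m) (n := phi (k + m))
    (n' := phi (k + m).+1); rewrite m0 mphi => /(_ isT (ltnW (phi_mono (ltnSn _)))).
  move=> h; have x0 : 0 < k.+1%:R :> R by rewrite ltr0n.
  have G0 : e * k.+1%:R ^+ 4 <= growth pn 1 (phi (k + m)).
    apply: le_trans (he _ (leq_trans m0 mphi)); rewrite ler_pM2l//.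
    apply: le_trans (phi_pow _); rewrite lerXn2r ?nnegrE// ler_nat ltnS.
    by rewrite leq_addr.
  have x4 : 0 < e * k.+1%:R ^+ 4 by rewrite mulr_gt0// exprn_gt0.
  have {}h := le_trans h (_ : _ <= m%:R / (e * k.+1%:R ^+ 4)).
  apply: le_trans (_ : _ <= k.+1%:R ^+ 2 * (m%:R / (e * k.+1%:R ^+ 4))) _.
    rewrite ler_wpM2l ?sqr_ge0// h// ler_wpM2l// lef_pV2 ?posrE//.
    exact: lt_le_trans G0.
  by rewrite powRN2 le_eqVlt; apply/orP; left; apply/eqP; field; rewrite !gt_eqF.
have S0 : (\int[P]_w (\sum_(k <oo) (X k w)%:E) < +oo)%E.
  rewrite integral_nneseries//; last by move=> k w _; rewrite lee_fin.
  apply: le_lt_trans (nneseries_EFin_lty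
    (v := fun k => m%:R / e * k.+1%:R `^ (- (1 + 1))) _).
    apply: lee_nneseries => [k _ _|k _]; last exact: EX.
    by apply: integral_ge0 => w _; rewrite lee_fin.
  rewrite (_ : series _ = (fun n => m%:R / e *
    series (fun k => k.+1%:R `^ (- (1 + 1))) n)); last first.
    by apply/funext => n; rewrite /series /= mulr_sumr.
  by apply: is_cvgM; [exact: is_cvg_cst|exact: is_cvg_series_powR].
have Si : P.-integrable setT (fun w => \sum_(k <oo) (X k w)%:E)%E.
  apply/integrableP; split.
    apply: ge0_emeasurable_sum => // k w _ _; by rewrite lee_fin.
  rewrite (eq_integral (fun w => \sum_(k <oo) (X k w)%:E)%E)// => w _.
  by rewrite gee0_abs//; apply: nneseries_ge0 => k _ _; rewrite lee_fin.
(* The sum of the [X k] has finite expectation, so it is finite almost surely. *)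
have := integrable_ae measurableT Si; apply: filterS => w /(_ I) fw cw.
have p1w : pres m w = 1 by rewrite /pres /present cw.
have cX : cvgn (series (X^~ w)).
  apply: nnseries_is_cvg => //; move: fw; rewrite fin_numE => /andP[_].
  by rewrite ltey.
have c2 := is_cvg_series_powR (@ltr01 R).
(* AM-GM: |D| <= y^2 D^2 + y^-2 with y = k+1 turns the summability of the
   second moments into absolute summability of the increments. *)
suff : cvgn (fun k => Z (phi (k + m)) w).
  by move=> /cvg_ex[l hl]; apply/cvg_ex; exists l; rewrite -(cvg_shiftn m).
suff /cvg_ex[l hl] : cvgn (series (telescope (fun k => Z (phi (k + m)) w))).
  rewrite telescopeK in hl; apply/cvg_ex; exists (l + Z (phi m) w).
  suff : (fun k => (Z (phi (k + m)) w - Z (phi m) w) + Z (phi m) w) @ \oo -->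
         l + Z (phi m) w by under eq_fun do rewrite subrK.
  by apply: cvgD => //; exact: cvg_cst.
apply: normed_cvg.
apply: (@series_le_cvg _ _ (fun k => X k w + k.+1%:R `^ (- (1 + 1)))) => //.
- by move=> k /=.
- by move=> k /=; rewrite addr_ge0// powR_ge0.
- move=> k; rewrite /telescope /= /X p1w mulr1 powRN2.
  rewrite -[_ - _]/(incr (k + m) w); set y := k.+1%:R; set D := incr _ _.
  have y0 : y != 0 by rewrite pnatr_eq0.
  have : 0 <= (y * `|D| - y^-1) ^+ 2 by exact: sqr_ge0.
  rewrite (_ : _ ^+ 2 = y ^+ 2 * `|D| ^+ 2 - 2 * `|D| + (y ^+ 2)^-1); last by field.
  rewrite real_normK ?num_real//; have := normr_ge0 D.
  by move: `|D| (y ^+ 2 * D ^+ 2) (y ^+ 2)^-1 => s t z; lra.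
rewrite (_ : series _ = (fun n => series (X^~ w) n +
   series (fun n => n.+1%:R `^ (- (1 + 1))) n)); last first.
  by apply/funext => n; rewrite /series /= big_split.
exact: is_cvgD.
Qed.

Lemma ae_cvg_Kcnt_present m : (0 < m)%N -> {ae P, forall w, (c <= Cnt (B^~ w) m)%N ->
  cvgn (fun n => (K n w)%:R / n%:R `^ q : R)}.
Proof.
move=> m0; have [l l0 hl] := growth_cvg pn01 p0 p1 beta0 pn_p.
apply: filterS (ae_cvg_scaled_subseq m0) => w + cw => /(_ cw)/cvg_ex[z hz].
apply/cvg_ex; exists (z * l).
apply: (@cvg_subseq_sandwich _ _ (fun n => n%:R `^ q) phi) => //.
- by move=> i j ij; rewrite ler_nat Kcnt_mono.
- by move=> n n0; rewrite powR_gt0// ltr0n.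
- by move=> i j ij; rewrite ge0_ler_powR ?nnegrE ?ler_nat// ltW.
- by rewrite /phi exp1n.
- exact: powR_expn_ratio_cvg.
rewrite (_ : (fun k => _) =
  (fun k => Z (phi k) w * (growth pn 1 (phi k) / (phi k)%:R `^ q))); last first.
  apply/funext => k; rewrite /Z /scaled mulrA divfK// gt_eqF//.
  by apply: growth_gt0 => //; lra.
apply: cvgM => //; apply: (cvg_comp _ _ _ hl).
apply/cvgnyPge => A; exists A => // k /= Ak.
exact: leq_trans Ak (ltnW (phi_gt k)).
Qed.
End Subsequence.

Lemma ae_cvg_Kcnt m : (0 < m)%N -> {ae P, forall w, (c <= Cnt (B^~ w) m)%N ->
  cvgn (fun n => (K n w)%:R / n%:R `^ q : R)}.
Proof.
(* Any integer [N >= 4 / q] serves as the exponent of the subsequence. *)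
apply: (@ae_cvg_Kcnt_present (Num.bound (4 / q))).
rewrite -ler_pdivrMr// ltW//; apply: archi_boundP.
by rewrite divr_ge0// ltW.
Qed.

(** By Fatou, the lower limit of [X k] has finite mean and is almost surely finite. Since [X k]
    squared is at least a constant times [n^q / (K+1)] at [n = k + m], convergence of [K / n^q] to 0
    would force [X k] to infinity. *)
Lemma ae_Kcnt_not_cvg0 m : (0 < m)%N ->
  {ae P, forall w, (c <= Cnt (B^~ w) m)%N ->
    ~ ((fun n => (K n w)%:R / n%:R `^ q : R) @ \oo --> (0 : R))}.
Proof.
move=> m0; have [C hC] := negative_moment rho0 urn pn01 c0 m0.
have [e e0 he] := growth_lower pn01 p0 p1 beta0 pn_p.
pose X k w : R := Num.sqrt (growth pn 1 (k + m)) *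
  negative_power (K (k + m) w) * pres m w.
have X0 k w : 0 <= X k w.
  apply: mulr_ge0; last exact: ler0n.
  by apply: mulr_ge0; [exact: sqrtr_ge0|exact: negative_power_ge0].
have Xi k : P.-integrable setT (EFin \o X k).
  apply: (bounded_adapted_integrable rho0 urn); apply: bounded_adaptedM.
    exact: (bounded_adapted_Kcnt B S c (k + m)
      (fun i => Num.sqrt (growth pn 1 (k + m)) * negative_power i)).
  exact: bounded_adapted_present.
have mX k : measurable_fun setT (fun w => (X k w)%:E) by exact: measurable_int (Xi k).
have F : (\int[P]_w limn_einf (fun k => (X k w)%:E) <= C%:E)%E.
  apply: le_trans (fatou P measurableT mX _) _.
    by move=> k w _; rewrite lee_fin.
  rewrite limn_einf_lim; apply: lime_le; first exact: is_cvg_einfs.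
  apply: nearW => k; apply: (@le_trans _ _ (\int[P]_w (X k w)%:E)%E).
    by apply: ereal_inf_lbound; exists k => /=.
  rewrite -[leLHS]fineK ?(integrable_fin_num measurableT (Xi k))// lee_fin.
  by apply: hC; rewrite leq_addl.
have F0 w : (0 <= limn_einf (fun k => (X k w)%:E))%E.
  rewrite limn_einf_lim; apply: lime_ge; first exact: is_cvg_einfs.
  apply: nearW => k; apply: le_ereal_inf_tmp => _ [j _ <-].
  by rewrite lee_fin.
have Fi : P.-integrable setT (fun w => limn_einf (fun k => (X k w)%:E)).
  apply/integrableP; split.
    (* Measurability of the lower limit is obtained from that of the upper limit by negation. *)
    rewrite (_ : (fun w => _) = (fun w => - limn_esup (fun k => - (X k w)%:E))%E).
      apply: measurableT_comp; first exact: oppe_measurable.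
      apply: measurable_fun_limn_esup => k.
      by apply: measurableT_comp => //; exact: oppe_measurable.
    by apply/funext => w; rewrite -limn_einfN; congr limn_einf; apply/funext => k /=;
      rewrite opprK.
  under eq_integral do rewrite gee0_abs//.
  exact: le_lt_trans F (ltry _).
have := integrable_ae measurableT Fi; apply: filterS => w /(_ I) fw cw h.
have p1w : pres m w = 1 by rewrite /pres /present cw.
suff /cvgeryP/cvg_limn_einf_sup[E _] : (fun k => X k w) @ \oo --> +oo.
  by move: fw; rewrite E.
apply/cvgryPge => A.
have h1 : (fun n => (K n w).+1%:R / n%:R `^ q : R) @ \oo --> (0 : R).
  rewrite -[0 in X in _ --> X]addr0.
  under eq_fun do rewrite -natr1 mulrDl mul1r.
  apply: cvgD => //; apply/gtr0_cvgV0; last exact: powR_cvg_infty.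
  by exists 1%N => // n /= n1; rewrite powR_gt0// ltr0n.
(* Below the threshold [e / (4 b)], [4 b (K+1) <= e n^q]; with [negative_power^2 (K+1) >= 1/4] this
   gives [X^2 >= b >= A^2]. *)
pose b := A ^+ 2 + 1.
have b0 : 0 < b by rewrite ltr_wpDl ?sqr_ge0.
have eb : 0 < e / (4 * b) by rewrite divr_gt0 ?mulr_gt0.
move/cvgrPdist_le : h1 => /(_ _ eb)[n0 _ hn0].
exists n0 => // k /= kn0; have := hn0 (k + m)%N (leq_trans kn0 (leq_addr _ _)).
rewrite /= sub0r normrN ger0_norm ?divr_ge0 ?powR_ge0// => hr.
rewrite /X p1w mulr1 (le_trans (ler_norm A))//.
rewrite -(@ler_pXn2r _ 2) ?nnegrE ?mulr_ge0 ?sqrtr_ge0 ?negative_power_ge0//.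
rewrite real_normK ?num_real// exprMn sqr_sqrtr; last first.
  by apply/ltW/growth_gt0 => //; lra.
have km0 : (0 < k + m)%N by rewrite addn_gt0 m0 orbT.
have := he _ km0; have := @negative_power_lowerS R (K (k + m) w).
set np := negative_power _; set G := growth _ _ _ => h2 h3.
have v0 : 0 < (k + m)%:R `^ q :> R by rewrite powR_gt0// ltr0n.
have k0 : 0 < (K (k + m) w).+1%:R :> R by rewrite ltr0n.
move: hr h2 h3 v0 k0; set v := _ `^ _; set y := _.+1%:R => hr h2 h3 v0 k0.
have {}hr : y * (4 * b) <= e * v by rewrite -ler_pdivlMr ?mulr_gt0// mulrAC -ler_pdivrMr.
have np2 : 0 <= np ^+ 2 by exact: sqr_ge0.
have := ler_wpM2r np2 h3; have := ler_wpM2r np2 hr.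
have := ler_wpM2l (ltW b0) h2.
have : A ^+ 2 <= b by rewrite lerDl.
by lra.
Qed.

(** The exceptional set depends on the time [m] by which [c] has appeared; a countable union over
    [m] removes this dependence. *)
Lemma ae_cvg_Kcnt_gt0 : {ae P, forall w, (exists n, (c <= Cnt (B^~ w) n)%N) ->
  exists2 l : R, 0 < l & (fun n => (K n w)%:R / n%:R `^ q : R) @ \oo --> l}.
Proof.
have H m : {ae P, forall w, (c <= Cnt (B^~ w) m.+1)%N ->
    exists2 l : R, 0 < l & (fun n => (K n w)%:R / n%:R `^ q : R) @ \oo --> l}.
  apply: filterS2 (ae_cvg_Kcnt (ltn0Sn m)) (ae_Kcnt_not_cvg0 (ltn0Sn m)).
  move=> w h1 h2 cw; have /cvg_ex[l hl] := h1 cw; exists l => //.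
  have l0 : 0 <= l.
    have <- := cvg_lim (@Rhausdorff R) hl.
    apply: limr_ge; first by apply/cvg_ex; exists l.
    by apply: nearW => n; rewrite divr_ge0// powR_ge0.
  rewrite lt_neqAle l0 andbT; apply/eqP => l_0.
  by apply: (h2 cw); rewrite l_0.
apply: filterS (ae_foralln H) => w h [n cn]; apply: (h n).
by apply: leq_trans cn _; exact: Cnt_mono.
Qed.

Lemma measurable_limit : measurable_fun setT
  (fun w => fine (limn_esup (fun n => ((K n w)%:R / n%:R `^ q)%:E))).
Proof.
apply: (measurableT_comp (fine_measurable measurableT)).
apply: measurable_fun_limn_esup => n; apply/measurable_EFinP.
apply: (measurable_fun_adapted rho0 urn (n := n)) => w0 w h.
by have /= e := adapted_Kcnt c h; rewrite /K e.
Qed.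

End UrnLimit.

Theorem theorem3p3 (R : realType) (d : measure_display) (T : measurableType d)
  (P : probability T R) (rho : R) (pn : nat -> R) (p beta : R)
  (B : nat -> T -> bool) (S : nat -> T -> nat) :
  0 < rho ->
  (forall n, (1 <= n)%N -> 0 < pn n < 1) ->
  0 <= p -> p < 1 -> p < beta ->
  (exists (M : R) (N : nat), forall n, (N <= n)%N ->
      `|pn n - p| <= M * (n%:R `^ (- beta))) ->
  is_triggered_urn P (fun x => rho * x) pn B S ->
  forall c : nat, (1 <= c)%N ->
  exists K : T -> R, measurable_fun setT K /\
    {ae P, forall w, (exists n, (c <= Cnt (B^~ w) n)%N) ->
       0 < K w /\
       ((fun n : nat => (Kcnt (S^~ w) n c)%:R / (n%:R `^ (1 - p)) : R) @ \oo --> K w)}.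
Proof.
move=> rho0 pn01 p0 p1 pbeta pn_p urn c c0.
have beta0 : 0 < beta := le_lt_trans p0 pbeta.
(* An upper limit is defined and measurable on the whole space, and agrees with the limit wherever
   the latter exists. *)
exists (fun w => fine (limn_esup
  (fun n => ((Kcnt (S^~ w) n c)%:R / n%:R `^ (1 - p))%:E))); split.
  exact: measurable_limit rho0 urn c.
apply: filterS (ae_cvg_Kcnt_gt0 rho0 pn01 p0 p1 beta0 pn_p urn c0) => w h cw.
have [l l0 hl] := h cw.
have hE : (fun n => ((Kcnt (S^~ w) n c)%:R / n%:R `^ (1 - p))%:E) @ \oo --> l%:E.
  by apply/fine_cvgP; split => //; exact: nearW.
by have [_ ->] := cvg_limn_einf_sup hE.
Qed.
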